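(* Suppose the Markov chain on $V$ is irreducible and transient, and fix vertices $a,b$. Let $g(v):=\mathbb{E}_v\sum_{t=0}^\infty \mathbf{1}[X_t=b]$ be the expected total number of visits to $b$ from $v$. Suppose that $\limsup_{v\in V}g(v)=0$ (i.e. for every $\epsilon>0$ there are only finitely many $v\in V$ with $g(v)>\epsilon$), and that the quantity $$K_5:=\sup_{v\in V} g(v)+\frac12\Big(d(b)+\sum_{u,v\in V} d(u)\,p(u,v)\,|g(u)-g(v)|\Big)$$ is finite. Then for any transfinite rotor walk started at $a$, and for any transfinite time $\tau=m\omega+t$ with $m\ge1$ at which all vertices have been visited only finitely often (i.e. $n_\tau(v)<\infty$ for all $v$), $$\left| g(a)-\frac{n_\tau(b)}{m} \right| \leq \frac{K_5}{m}.$$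
   Context: Markov chain: $V$ is a countable set and $p:V\times V\to[0,1]$ are the transition probabilities of a Markov chain $X_0,X_1,\ldots$ on $V$; all $p(u,v)$ are rational, and for each $u$ there are only finitely many $v$ with $p(u,v)>0$. $\mathbb{E}_u$ is expectation for the chain started at $X_0=u$. Rotor mechanism: to each vertex $u$ are associated a positive integer $d(u)$ and a finite sequence of (not necessarily distinct) vertices $u^{(1)},\ldots,u^{(d(u))}$ (the successors of $u$) such that $p(u,v)=\#\{i:u^{(i)}=v\}/d(u)$ for all $u,v\in V$. Rotor walk: a rotor configuration is a map $r$ assigning to each $v\in V$ an integer $r(v)\in\{1,\ldots,d(v)\}$. Given an initial vertex $x_0$ and an initial rotor configuration $r_0$, the rotor walk is defined inductively: $r_{t+1}(v)=r_t(v)$ for $v\ne x_t$; $r_{t+1}(x_t)=r_t(x_t)+1$ if $r_t(x_t)<d(x_t)$ and $r_{t+1}(x_t)=1$ if $r_t(x_t)=d(x_t)$; and $x_{t+1}:=(x_t)^{(r_{t+1}(x_t))}$. A rotor walk is recurrent if it visits every vertex infinitely often, transient if it visits every vertex only finitely often; for an irreducible chain every rotor walk is one or the other. Transfinite rotor walk started at $a$: fix an initial rotor configuration $r_0$ and set $x_0=a$. If the rotor walk $x_0,x_1,\ldots$ is transient, set $r_\omega(v):=\lim_{t\to\infty}r_t(v)$, $x_\omega:=a$, and run the rotor walk $x_\omega,x_{\omega+1},\ldots$ from $(x_\omega,r_\omega)$ by the usual rules; if this is again transient set $r_{2\omega}:=\lim_{t\to\infty} r_{\omega+t}$, $x_{2\omega}:=a$,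 and so on. Continue up to the first $m$ for which the walk $x_{m\omega},x_{m\omega+1},\ldots$ is recurrent (after which no further restart is made), or indefinitely if it is transient for all $m$. Transfinite times are $\omega^2$ and $m\omega+t$ with $m,t$ non-negative integers, ordered lexicographically by $(m,t)$, with $m\omega+t<\omega^2$. For a transfinite time $\tau$, $n_\tau(v):=\#\{\alpha<\tau: x_\alpha=v\}$ (over times $\alpha$ at which the walk is defined). *)

(* Defs.v *)
From HB Require Import structures.
From mathcomp Require Import all_boot all_order all_algebra.
From mathcomp Require Import all_classical all_reals all_analysis.

Set Implicit Arguments.
Unset Strict Implicit.
Unset Printing Implicit Defensive.

Import Order.TTheory GRing.Theory Num.Theory.
Import numFieldNormedType.Exports.

Local Open Scope classical_set_scope.
Local Open Scope ring_scope.
Local Open Scope ereal_scope.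

Definition transition_probabilities (R : realType) (V : countType)
    (p : V -> V -> R) : Prop :=
  (forall u v, (0 <= p u v <= 1)%R) /\
  (forall u, \esum_(v in [set: V]) (p u v)%:E = 1).

Definition rational_transitions (R : realType) (V : countType)
    (p : V -> V -> R) : Prop :=
  forall u v, exists q : rat, p u v = ratr q.

Definition finitely_many_transitions (R : realType) (V : countType)
    (p : V -> V -> R) : Prop :=
  forall u, finite_set [set v | (0 < p u v)%R].

(* The Markov property is written multiplicatively, so that conditioning on a
   null event imposes nothing. *)
Record markov_chain_from (R : realType) (V : countType) (p : V -> V -> R)
    (dsp : measure_display) (Omega : measurableType dsp)
    (P : probability Omega R) (X : nat -> Omega -> V) (u : V) : Prop :=
  MarkovChainFrom {
    chain_measurable : forall t v, measurable [set w | X t w = v];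
    chain_start : P [set w | X 0%N w = u] = 1;
    chain_step : forall (n : nat) (x : nat -> V),
      P [set w | forall i, (i <= n.+1)%N -> X i w = x i] =
      P [set w | forall i, (i <= n)%N -> X i w = x i] * (p (x n) (x n.+1))%:E
  }.

Definition irreducible_chain (R : realType) (V : countType)
    (dsp : measure_display) (Omega : measurableType dsp)
    (P : V -> probability Omega R) (X : nat -> Omega -> V) : Prop :=
  forall u v, exists t, 0 < P u [set w | X t w = v].

Definition transient_chain (R : realType) (V : countType)
    (dsp : measure_display) (Omega : measurableType dsp)
    (P : V -> probability Omega R) (X : nat -> Omega -> V) : Prop :=
  forall u, P u [set w | exists t, (0 < t)%N /\ X t w = u] < 1.

Definition expected_visits (R : realType) (V : countType)
    (dsp : measure_display) (Omega : measurableType dsp)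
    (P : V -> probability Omega R) (X : nat -> Omega -> V) (b v : V) : \bar R :=
  \int[P v]_w \sum_(0 <= t <oo) ((X t w == b)%:R)%:E.

(* [succ u] lists u^(1), ..., u^(d(u)). *)
Definition rotor_degree (V : countType) (succ : V -> seq V) (u : V) : nat :=
  size (succ u).

Definition successor (V : countType) (succ : V -> seq V) (u : V) (i : nat) : V :=
  nth u (succ u) i.-1.

Definition rotor_mechanism (R : realType) (V : countType) (p : V -> V -> R)
    (succ : V -> seq V) : Prop :=
  (forall u, (0 < rotor_degree succ u)%N) /\
  (forall u v,
     p u v = ((count_mem v (succ u))%:R / (rotor_degree succ u)%:R)%R).

Definition rotor_configuration (V : countType) (succ : V -> seq V)
    (r : V -> nat) : Prop :=
  forall v, (1 <= r v <= rotor_degree succ v)%N.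

Definition rotor_update (V : countType) (succ : V -> seq V) (x : V)
    (r : V -> nat) : V -> nat :=
  fun v => if v == x then
             if (r x < rotor_degree succ x)%N then (r x).+1 else 1%N
           else r v.

Definition rotor_step (V : countType) (succ : V -> seq V)
    (s : V * (V -> nat)) : V * (V -> nat) :=
  let r' := rotor_update succ s.1 s.2 in (successor succ s.1 (r' s.1), r').

Definition rotor_walk (V : countType) (succ : V -> seq V) (x0 : V)
    (r0 : V -> nat) (t : nat) : V * (V -> nat) :=
  iter t (rotor_step succ) (x0, r0).

Definition transient_rotor_walk (V : countType) (succ : V -> seq V) (x0 : V)
    (r0 : V -> nat) : Prop :=
  forall v, finite_set [set t | (rotor_walk succ x0 r0 t).1 = v].

(* r_{m omega}; meaningful only if the first m walks are transient (otherwise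
   [lim] may be a dummy value), see [defined_level]. *)
Fixpoint level_rotors (V : countType) (succ : V -> seq V) (a : V)
    (r0 : V -> nat) (m : nat) : V -> nat :=
  if m is k.+1 then
    fun v => lim ((fun t => (rotor_walk succ a (level_rotors succ a r0 k) t).2 v)
                    @ \oo)
  else r0.

Definition defined_level (V : countType) (succ : V -> seq V) (a : V)
    (r0 : V -> nat) (m : nat) : Prop :=
  forall k, (k < m)%N -> transient_rotor_walk succ a (level_rotors succ a r0 k).

(* The pair (m, t) stands for the transfinite time m omega + t. *)
Definition transfinite_walk (V : countType) (succ : V -> seq V) (a : V)
    (r0 : V -> nat) (alpha : nat * nat) : V :=
  (rotor_walk succ a (level_rotors succ a r0 alpha.1) alpha.2).1.

Definition time_lt (alpha tau : nat * nat) : bool :=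
  ((alpha.1 < tau.1) || ((alpha.1 == tau.1) && (alpha.2 < tau.2)))%N.

Definition visits (R : realType) (V : countType) (succ : V -> seq V) (a : V)
    (r0 : V -> nat) (tau : nat * nat) (v : V) : \bar R :=
  counting [set alpha | [/\ time_lt alpha tau,
                            defined_level succ a r0 alpha.1 &
                            transfinite_walk succ a r0 alpha = v]].

Definition K5 (R : realType) (V : countType) (p : V -> V -> R)
    (succ : V -> seq V) (g : V -> \bar R) (b : V) : \bar R :=
  ereal_sup (range g) +
  (2^-1)%:E *
  ((rotor_degree succ b)%:R%:E +
   \esum_(e in [set: V * V])
     ((rotor_degree succ e.1)%:R * p e.1 e.2)%:E * `|g e.1 - g e.2|).

(* Main.v *)
(* For each vertex v let psi_v(j) be the sum over i <= j of
   g(v^(i)) - g(v) + 1[v = b].  Since g(v) = 1[v = b] + (mean of g over the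
   successors of v), psi_v vanishes after a full turn of the rotor, and one step
   of the walk preserves g(x_t) + n_t(b) - sum_v psi_v(r_t(v)).  At the end of a
   transient level g(x_t) tends to 0 and the rotors converge, so each restart
   adds g(a) to the conserved quantity; hence n_tau(b) - m g(a) equals
   g(a) - g(x_tau) plus the total change of psi.  As psi_v is a partial sum of a
   cyclic sequence of sum zero, it varies by at most half of the sum of the
   absolute values of that sequence, which gives K_5. *)
Require Import Defs.
From mathcomp Require Import all_boot all_order all_algebra.
From mathcomp Require Import all_classical all_reals all_analysis.
From mathcomp Require Import finmap measurable_realfun lra.

Import Order.TTheory GRing.Theory Num.Theory.
Import numFieldNormedType.Exports.

Local Open Scope classical_set_scope.
Local Open Scope ring_scope.

(** * Rotor potentials and the conserved quantity along a single walk *)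

Section RotorPotential.
Context {R : realType} {V : countType}.
Variables (succ : V -> seq V) (g : V -> R) (b : V).
Implicit Types (v w x a : V) (r : V -> nat) (F S : seq V).

(* The term [v == b] makes the increments over a full turn of the rotor sum to
   zero when [g] counts the expected visits to [b]. *)
Definition increment v w : R := g w - g v + (v == b)%:R.

Definition rotor_potential v (j : nat) : R :=
  \sum_(0 <= i < j) increment v (nth v (succ v) i).

Definition oscillation v : R := \sum_(w <- succ v) `|increment v w|.

Hypothesis increment_sum0 : forall v, \sum_(w <- succ v) increment v w = 0.
Hypothesis degree_gt0 : forall v, (0 < rotor_degree succ v)%N.

Lemma rotor_potential_degree v : rotor_potential v (rotor_degree succ v) = 0.
Proof. by rewrite /rotor_potential -[RHS](increment_sum0 v) [RHS](big_nth v). Qed.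

(** Cut the full turn at [k] and [j] into blocks with sums [A], [B], [C]. The difference of
    potentials is [B], and also [- (A + C)] because a full turn sums to zero; hence
    [2 * |B| <= |A| + |B| + |C|], which is at most the oscillation. *)
Lemma rotor_potential_osc v j k :
  (j <= rotor_degree succ v)%N -> (k <= rotor_degree succ v)%N ->
  `|rotor_potential v j - rotor_potential v k| <= oscillation v / 2.
Proof.
wlog kj : j k / (k <= j)%N => [hw hj hk|hj hk].
  by case/orP: (leq_total k j) => h; [exact: hw|rewrite distrC; exact: hw].
have := rotor_potential_degree v.
rewrite /oscillation (big_nth v) -/(rotor_degree succ v) /rotor_potential.
rewrite !(big_cat_nat (leq0n j) hj) !(big_cat_nat (leq0n k) kj) /=.
have := ler_norm_sum (index_iota 0 k) (fun i => increment v (nth v (succ v) i)) xpredT.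
have := ler_norm_sum (index_iota k j) (fun i => increment v (nth v (succ v) i)) xpredT.
have := ler_norm_sum (index_iota j (rotor_degree succ v))
  (fun i => increment v (nth v (succ v) i)) xpredT.
set A := \sum_(0 <= i < k) _; set B := \sum_(k <= i < j) _.
set C := \sum_(j <= i < _) _.
rewrite !ler_norml => /andP[? ?] /andP[? ?] /andP[? ?] h.
by apply/andP; split; lra.
Qed.

Lemma rotor_update_configuration x r :
  rotor_configuration succ r -> rotor_configuration succ (rotor_update succ x r).
Proof.
move=> hr v; rewrite /rotor_update; case: eqP => [->|_]; last exact: hr.
by case: ifP => [->//|_]; rewrite degree_gt0.
Qed.

Lemma rotor_walk_configuration a r T :
  rotor_configuration succ r ->
  rotor_configuration succ (rotor_walk succ a r T).2.
Proof. by move=> hr; elim: T => //= T; exact: rotor_update_configuration. Qed.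

(** Turning the rotor adds the increment towards the vertex visited next: positions start at 1 and
    list indices at 0, so passing from [r x] to [(r x).+1] adds the entry of index [r x]. On
    wrap-around the old potential is zero and the new one is the first increment. *)
Lemma rotor_potential_update x r : rotor_configuration succ r ->
  let j := rotor_update succ x r x in
  g (successor succ x j) + (x == b)%:R - rotor_potential x j =
  g x - rotor_potential x (r x).
Proof.
move=> hr /=; rewrite /rotor_update eqxx /successor.
have /andP[r1 rd] := hr x.
have [lt_rd|le_dr] := ltnP.
  by rewrite /rotor_potential big_nat_recr //= /increment; lra.
have -> : r x = rotor_degree succ x by apply/eqP; rewrite eqn_leq rd.
by rewrite rotor_potential_degree /rotor_potential big_nat1 /= /increment; lra.
Qed.

Definition level_visits a r T : nat :=
  \sum_(0 <= i < T) ((rotor_walk succ a r i).1 == b).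

(** Only rotors at vertices already left have moved, and [S] contains these, so the finite sum
    records the whole change of potential. *)
Lemma rotor_walk_invariant a r T S : rotor_configuration succ r -> uniq S ->
  (forall i, (i < T)%N -> (rotor_walk succ a r i).1 \in S) ->
  g (rotor_walk succ a r T).1 + (level_visits a r T)%:R
    - \sum_(v <- S) (rotor_potential v ((rotor_walk succ a r T).2 v)
                     - rotor_potential v (r v)) = g a.
Proof.
move=> hr uS; elim: T => [|T IH] hS.
  by rewrite /level_visits big_nil big1_idem//= ?subrr;
    [lra|rewrite addr0|move=> v _; rewrite subrr].
rewrite -[RHS]IH; last by move=> i /ltnW; exact: hS.
have hc := rotor_walk_configuration a _ T hr.
have := hS T (ltnSn T).
rewrite /level_visits big_nat_recr //= natrD.
move: hc; case: (rotor_walk succ a r T) => x r' /= hc xS.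
have /= := rotor_potential_update x _ hc.
(* Only the rotor at [x] moves: its term is split off, and the other terms agree before and after
   the step. *)
rewrite !(bigD1_seq x xS uS) /=.
rewrite (eq_bigr (fun v => rotor_potential v (r' v) - rotor_potential v (r v))); last first.
  by move=> v /negPf vx; rewrite /rotor_update vx.
by lra.
Qed.

(* Working up to such tails replaces infinite sums over [V] by sums over [F]. *)
Definition tail_le F (eps : R) : Prop :=
  forall S, uniq S -> {in S, forall v, v \notin F} ->
  \sum_(v <- S) oscillation v <= eps.

(** Choose [F] whose oscillation sum is within [eps] of the supremum over finite sets: a disjoint
    [S] of sum above [eps] would push [F ++ S] beyond the supremum. *)
Lemma tail_leP (C eps : R) :
  (forall S, uniq S -> \sum_(v <- S) oscillation v <= C) -> 0 < eps ->
  exists2 F, uniq F & tail_le F eps.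
Proof.
move=> hC eps0.
pose A := [set \sum_(v <- S) oscillation v | S in [set S | uniq S]].
have Asup : has_sup A.
  by split; [exists 0, [::]; rewrite ?big_nil|exists C => _ [S /hC ? <-]].
have [_ [F uF <-] ltF] := sup_adherent eps0 Asup.
exists F => // S uS dS.
have : \sum_(v <- F ++ S) oscillation v <= sup A.
  apply: ub_le_sup; first by case: Asup.
  exists (F ++ S) => //=; rewrite cat_uniq uF uS andbT.
  by apply/hasPn => v /dS.
by rewrite big_cat /=; lra.
Qed.

(** The invariant with a fixed [F] in place of the visited set, which grows with [T]. The price is
    half of the tail, by the oscillation bound at each visited vertex outside [F] (these form
    [E]). *)
Lemma level_deviation a r T F (eps : R) :
  rotor_configuration succ r -> uniq F -> tail_le F eps ->
  `|(level_visits a r T)%:R - g a + g (rotor_walk succ a r T).1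
    - \sum_(v <- F) (rotor_potential v ((rotor_walk succ a r T).2 v)
                     - rotor_potential v (r v))| <= eps / 2.
Proof.
move=> hr uF hF.
pose E := [seq v <- undup [seq (rotor_walk succ a r i).1 | i <- iota 0 T] | v \notin F].
have uE : uniq E by rewrite filter_uniq ?undup_uniq.
have dE : {in E, forall v, v \notin F} by move=> v;
  rewrite mem_filter => /andP[].
have uFE : uniq (F ++ E).
  by rewrite cat_uniq uF uE andbT; apply/hasPn => v /dE.
have := rotor_walk_invariant a _ T _ hr uFE.
rewrite big_cat /= => <-; last first.
  move=> i iT; rewrite mem_cat mem_filter mem_undup.
  case: (_ \in F) => //=; apply/mapP; exists i => //.
  by rewrite mem_iota.
set A := \sum_(v <- F) _; set B := \sum_(v <- E) _.
rewrite (_ : _ - _ = B); last by lra.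
apply: le_trans (_ : (\sum_(v <- E) oscillation v) / 2 <= _); last first.
  by have := hF _ uE dE; lra.
apply: le_trans (ler_norm_sum _ _ _) _; rewrite mulr_suml.
apply: ler_sum => v _; apply: rotor_potential_osc.
  by case/andP: (rotor_walk_configuration a _ T hr v).
by case/andP: (hr v).
Qed.

End RotorPotential.

(** * Finite sets and the counting measure *)

Lemma finite_set_nat_bound (A : set nat) :
  finite_set A -> exists N, forall t, (N <= t)%N -> ~ A t.
Proof.
move=> /finite_seqP[s ->]; exists (\max_(i <- s) i).+1 => t lt_t /= ts.
by have := @leq_bigmax_seq _ s xpredT id t ts isT; rewrite leqNgt lt_t.
Qed.

Lemma counting_seq (R : realType) (T : choiceType) (s : seq T) :
  uniq s -> counting [set` s] = (size s)%:R%:E :> \bar R.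
Proof.
move=> us; rewrite /counting asboolT; last exact: finite_seq.
have -> : [set` s] = [set` [fset x in s]%fset] by apply/seteqP; split=> x /=;
  rewrite !inE.
by rewrite set_fsetK card_fseq undup_id.
Qed.

Lemma counting_finite (R : realType) (T : choiceType) (A : set T) :
  (counting A < +oo :> \bar R)%E -> finite_set A.
Proof. by rewrite /counting; case: ifPn => [/asboolP//|]; rewrite ltxx. Qed.

(** * Limits of rotors and visit counts over several levels *)

Section TransfiniteWalk.
Context {V : countType}.
Variables (succ : V -> seq V) (a : V).
Hypothesis degree_gt0 : forall v, (0 < rotor_degree succ v)%N.

Lemma transient_leaves_finite_set r (B : set V) :
  transient_rotor_walk succ a r -> finite_set B ->
  exists T0, forall T, (T0 <= T)%N -> ~ B (rotor_walk succ a r T).1.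
Proof.
move=> tr fB.
have [|N hN] := finite_set_nat_bound
  (\bigcup_(v in B) [set t | (rotor_walk succ a r t).1 = v]).
  by apply: bigcup_finite => // v _; exact: tr.
by exists N => T /hN h BT; apply: h; exists (rotor_walk succ a r T).1.
Qed.

(** After the last visit to [F] no rotor on [F] moves, so the sequence whose limit defines the next
    level is eventually constant there. *)
Lemma level_rotors_eventually r0 k (F : seq V) :
  transient_rotor_walk succ a (level_rotors succ a r0 k) ->
  exists T0, forall T, (T0 <= T)%N -> {in F, forall v,
    (rotor_walk succ a (level_rotors succ a r0 k) T).2 v =
    level_rotors succ a r0 k.+1 v}.
Proof.
move=> tr; have [T0 hT0] := transient_leaves_finite_set _ _ tr (finite_seq F).
have cst v T : v \in F -> (T0 <= T)%N ->
    (rotor_walk succ a (level_rotors succ a r0 k) T).2 v =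
    (rotor_walk succ a (level_rotors succ a r0 k) T0).2 v.
  move=> vF; elim: T => [|T IH]; first by rewrite leqn0 => /eqP ->.
  rewrite leq_eqVlt => /predU1P[<-//|]; rewrite ltnS => le_T.
  rewrite -[RHS](IH le_T) /= /rotor_update; case: eqP => // E.
  by case: (hT0 T le_T); rewrite -E.
exists T0 => T le_T v vF; rewrite cst//=; apply/esym; apply: lim_near_cst;
  first exact: order_hausdorff.
by exists T0 => // T' /= /(cst _ _ vF).
Qed.

Lemma level_rotors_configuration r0 m :
  rotor_configuration succ r0 -> defined_level succ a r0 m ->
  rotor_configuration succ (level_rotors succ a r0 m).
Proof.
move=> hr0; elim: m => [//|m IH] hm v.
(* The limit at [v] is a value attained at a finite time, hence an admissible one. *)
have [T /(_ T (leqnn T) v (mem_head _ _)) <-] :=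
  level_rotors_eventually _ _ [:: v] (hm m (ltnSn m)).
apply: rotor_walk_configuration => //; apply: IH => k km.
by apply: hm; exact: ltnW.
Qed.

(** Strong induction on the level: once the levels below [k] are transient, each visit to [v] during
    level [k < m] is among the times counted by [visits], so finite counts make level [k]
    transient. *)
Lemma visits_defined_level (R : realType) r0 m t :
  (forall v, (visits R succ a r0 (m, t) v < +oo)%E) ->
  defined_level succ a r0 m.
Proof.
move=> hv k; elim/ltn_ind: k => k IH km v.
apply: (sub_finite_set _
  (finite_image snd (counting_finite _ _ _ (hv v)))) => i /= Ei.
exists (k, i) => //; split=> //; first by rewrite /time_lt /= km.
by move=> j jk; apply: IH => //; exact: ltn_trans km.
Qed.

Lemma level_visits_count b r T :
  level_visits succ b a r T =
  size [seq i <- iota 0 T | (rotor_walk succ a r i).1 == b].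
Proof.
by rewrite size_filter -sum1_count [RHS]big_mkcond /level_visits /index_iota subn0.
Qed.

(** By transience no completed level visits [b] after some common time, so truncating these levels
    at any later [T] loses nothing. Leaving [T] free allows it to meet other thresholds too. *)
Lemma visits_level_visits (R : realType) b r0 m t : defined_level succ a r0 m ->
  exists T0, forall T, (T0 <= T)%N ->
  visits R succ a r0 (m, t) b =
  (\sum_(0 <= k < m) level_visits succ b a (level_rotors succ a r0 k) T
   + level_visits succ b a (level_rotors succ a r0 m) t)%:R%:E.
Proof.
move=> hm.
have [T0 hT0] : exists T0, forall k T, (k < m)%N -> (T0 <= T)%N ->
    (rotor_walk succ a (level_rotors succ a r0 k) T).1 != b.
  (* The bound on [k] is generalized to [n <= m], while [hm] still speaks of all [m] levels. *)
  elim: {1 3}m (leqnn m) => [|n IH] nm; first by exists 0%N.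
  have [T1 h1] := IH (ltnW nm).
  have [T2 h2] := transient_leaves_finite_set _ _ (hm n nm) (finite_set1 b).
  exists (maxn T1 T2) => k T;
    rewrite ltnS leq_eqVlt geq_max => kn /andP[le1 le2].
  by case/predU1P: kn => [->|kn]; [apply/eqP; exact: h2|exact: h1].
exists T0 => T le_T.
(* Visit times are cut at [T] in a completed level and at [t] in the last one; the pairs in [s] then
   enumerate, without repetition, the set counted by [visits]. *)
pose L k := [seq i <- iota 0 (if (k < m)%N then T else t) |
  (rotor_walk succ a (level_rotors succ a r0 k) i).1 == b].
pose s := [seq (k, i) | k <- iota 0 m.+1, i <- L k].
have -> : visits R succ a r0 (m, t) b = counting [set` s].
  congr counting; apply/seteqP; split => -[k i] /=;
    rewrite /time_lt /transfinite_walk /=.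
    move=> [lt_ki _ Eb]; apply/allpairsPdep; exists k, i.
    rewrite mem_iota mem_filter mem_iota Eb eqxx !add0n /=; split => //.
      by case/orP: lt_ki => [/ltnW//|/andP[/eqP-> _]].
    case: ifPn lt_ki => [km _|_ /=]; last by case/andP.
    by rewrite ltnNge; apply: contraTN isT => /(leq_trans le_T) /(hT0 _ _ km);
      rewrite Eb eqxx.
  move=> /allpairsPdep[k' [i' [+ + [-> ->]]]];
    rewrite mem_iota mem_filter mem_iota !add0n /= ltnS.
  move=> km /andP[/eqP Eb lt_i]; split => //.
    by move: km lt_i; rewrite leq_eqVlt => /predU1P[->|->//];
      rewrite ltnn eqxx => ->.
  by move=> j jk; apply: hm; exact: leq_trans jk km.
rewrite counting_seq; last first.
  apply: allpairs_uniq_dep => [|k _|[k i] [k' i'] _ _ /= [-> ->]//];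
    rewrite ?filter_uniq ?iota_uniq//.
rewrite size_allpairs_dep sumnE big_map -(subn0 m.+1) -/(index_iota 0 m.+1) big_nat_recr//=.
rewrite /L ltnn level_visits_count; congr (_ %:R%:E); congr addn.
by apply: eq_big_nat => k /= ->; rewrite level_visits_count.
Qed.

End TransfiniteWalk.

(** * Deviation of the number of visits from [m] times [g a] *)

Section Deviation.
Context {R : realType} {V : countType}.
Variables (succ : V -> seq V) (g : V -> R) (a b : V).
Hypothesis increment_sum0 : forall v, \sum_(w <- succ v) increment g b v w = 0.
Hypothesis degree_gt0 : forall v, (0 < rotor_degree succ v)%N.
Hypothesis g_ge0 : forall v, 0 <= g v.
Hypothesis g_vanishes : forall eps, 0 < eps -> finite_set [set v | eps < g v].
Variable r0 : V -> nat.
Hypothesis hr0 : rotor_configuration succ r0.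

Let psi := rotor_potential succ g b.
Let lr := level_rotors succ a r0.

(** Each completed level contributes [g a] plus a change of potential on [F], with an error of at
    most [eps / 2] from outside [F] and [eps] from the final value of [g]; [2 * eps] covers both. *)
Lemma transfinite_deviation m (F : seq V) (eps : R) : 0 < eps -> uniq F ->
  tail_le succ g b F eps -> defined_level succ a r0 m ->
  exists T0, forall T, (T0 <= T)%N ->
  `|(\sum_(0 <= k < m) level_visits succ b a (lr k) T)%:R - m%:R * g a
    - \sum_(v <- F) (psi v (lr m v) - psi v (r0 v))| <= m%:R * (2 * eps).
Proof.
move=> eps0 uF hF; elim: m => [|m IH] hm.
  exists 0%N => T _; rewrite big_nil mul0r big1 ?subr0 ?normr0 ?mul0r// => v _.
  by rewrite subrr.
have hm' : defined_level succ a r0 m by move=> k /ltnW; exact: hm.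
have [T1 h1] := IH hm'.
have tr := hm m (ltnSn m).
have [T2 h2] := transient_leaves_finite_set _ _ _ _ tr (g_vanishes _ eps0).
have [T3 h3] := level_rotors_eventually _ _ _ _ F tr.
(* From this time on the induction hypothesis applies, the walk stays where [g] is at most [eps],
   and the rotors on [F] have reached their limits. *)
exists (maxn T1 (maxn T2 T3)) => T;
  rewrite !geq_max => /and3P[/h1 H1 /h2 H2 /h3 H3].
have hc := level_rotors_configuration _ _ degree_gt0 _ _ hr0 hm'.
have := level_deviation _ _ _ increment_sum0 degree_gt0 a _ T _ _ hc uF hF.
rewrite -/(lr m) -/psi in H2 H3 *.
move/negP: H2; rewrite -leNgt.
have := g_ge0 (rotor_walk succ a (lr m) T).1.
move: H1.
have -> : \sum_(v <- F) (psi v ((rotor_walk succ a (lr m) T).2 v) - psi v (lr m v))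
        = \sum_(v <- F) (psi v (lr m.+1 v) - psi v (lr m v)).
  by apply: eq_big_seq => v /H3 ->.
rewrite big_nat_recr//= natrD -(@natr1 R m).
(* Changes of potential telescope over the levels, so only the net change since [r0] remains. *)
have -> : \sum_(v <- F) (psi v (lr m.+1 v) - psi v (r0 v)) =
  \sum_(v <- F) (psi v (lr m.+1 v) - psi v (lr m v)) +
  \sum_(v <- F) (psi v (lr m v) - psi v (r0 v)).
  by rewrite -big_split /=; apply: eq_bigr => v _; rewrite addrA subrK.
rewrite !mulrDl !mul1r; set x := _ * g a; set y := m%:R * _.
rewrite !ler_norml => /andP[? ?] ? ? /andP[? ?].
by apply/andP; split; lra.
Qed.

Lemma transfinite_visits_bound (C G : R) m t : defined_level succ a r0 m ->
  (forall S, uniq S -> \sum_(v <- S) oscillation succ g b v <= C) ->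
  (forall v, g v <= G) ->
  exists n : nat, visits R succ a r0 (m, t) b = n%:R%:E /\
    `|n%:R - m%:R * g a| <= G + C / 2.
Proof.
move=> hm hC hG.
have [T0 hT0] := visits_level_visits _ _ R b _ _ t hm.
pose n := (\sum_(0 <= k < m) level_visits succ b a (lr k) T0
   + level_visits succ b a (lr m) t)%N.
have En : visits R succ a r0 (m, t) b = n%:R%:E by exact: hT0.
exists n; split => //.
(* The errors are [m * (2 * eps)] from the completed levels and [eps / 2] from the unfinished one,
   with [eps] arbitrary. *)
suff H (eps : R) : 0 < eps ->
    `|n%:R - m%:R * g a| <= G + C / 2 + (m%:R * 2 + 1 / 2) * eps.
  apply/ler_addgt0Pr => e e0.
  have h : 0 < m%:R * 2 + 1 / 2 :> R by apply: ltr_wpDl; [rewrite mulr_ge0|lra].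
  have := H (e / (m%:R * 2 + 1 / 2)) (divr_gt0 e0 h).
  by rewrite mulrCA divff ?mulr1// gt_eqF.
move=> eps0; have [F uF hF] := tail_leP _ _ _ _ _ hC eps0.
have [T1 h1] := transfinite_deviation _ _ _ eps0 uF hF hm.
(* [n] does not depend on the truncation time, so it is rewritten at one late enough for both
   estimates. *)
have := h1 (maxn T0 T1) (leq_maxr _ _).
have := hT0 (maxn T0 T1) (leq_maxl _ _).
rewrite En => -[/(mulrIn (oner_neq0 _)) ->].
have hc := level_rotors_configuration _ _ degree_gt0 _ _ hr0 hm.
have := level_deviation _ _ _ increment_sum0 degree_gt0 a _ t _ _ hc uF hF.
rewrite -/(lr m) -/psi natrD.
set x := (rotor_walk _ _ _ _).1; set r := (rotor_walk _ _ _ _).2.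
have hr : rotor_configuration succ r by exact: rotor_walk_configuration.
(* The net change from [r0] to the current rotors costs half an oscillation per vertex, whatever the
   number of levels. *)
have : `|\sum_(v <- F) (psi v (r v) - psi v (lr m v)) +
    \sum_(v <- F) (psi v (lr m v) - psi v (r0 v))| <= C / 2.
  rewrite -big_split /=.
  apply: le_trans (_ : (\sum_(v <- F) oscillation succ g b v) / 2 <= _);
    last first.
    by have := hC _ uF; lra.
  apply: le_trans (ler_norm_sum _ _ _) _; rewrite mulr_suml.
  apply: ler_sum => v _; rewrite addrA subrK; apply: rotor_potential_osc => //.
    by case/andP: (hr v).
  by case/andP: (hr0 v).
(* Both [g a] and [g x] lie between 0 and [G], so their difference contributes at most [G]. *)
have := hG x; have := g_ge0 x; have := hG a; have := g_ge0 a.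
have -> : (m%:R * 2 + 1 / 2) * eps = m%:R * (2 * eps) + eps / 2 by lra.
set y := m%:R * (2 * eps); set z := m%:R * g a.
rewrite !ler_norml => ? ? ? ? /andP[? ?] /andP[? ?] /andP[? ?].
by apply/andP; split; lra.
Qed.

End Deviation.

(** * Visit probabilities of the chain and the first-step equation *)

Lemma sum_undup_count (R : nzRingType) (T : eqType) (s : seq T) (f : T -> R) :
  \sum_(y <- undup s) (count_mem y s)%:R * f y = \sum_(y <- s) f y.
Proof.
rewrite -[RHS]big_undup_iterop_count /=; apply: eq_bigr => y _.
by rewrite mulr_natl.
Qed.

Local Open Scope ereal_scope.

Section Chain.
Context {R : realType} {V : countType} {dsp : measure_display}.
Context {Omega : measurableType dsp}.
Variables (p : V -> V -> R) (succ : V -> seq V) (X : nat -> Omega -> V) (b : V).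
Hypothesis hrotor : rotor_mechanism p succ.

(** The [n]-step transition probability from [u] to [b], as iterated averages over successor lists
    so that all sums are finite; [measure_visit] ties it to the chain. *)
Fixpoint visit_probability (n : nat) (u : V) : R :=
  (if n is k.+1 then
     (rotor_degree succ u)%:R^-1 * \sum_(w <- succ u) visit_probability k w
   else (u == b)%:R)%R.

Lemma visit_probability_ge0 n u : (0 <= visit_probability n u)%R.
Proof.
elim: n u => [|n IH] u /=; first by rewrite ler0n.
by rewrite mulr_ge0 ?invr_ge0 ?ler0n ?sumr_ge0.
Qed.

Lemma transition_sum u (f : V -> R) :
  (\sum_(y <- undup (succ u)) p u y * f y =
   (rotor_degree succ u)%:R^-1 * \sum_(y <- succ u) f y)%R.
Proof.
rewrite -[in RHS]sum_undup_count mulr_sumr; apply: eq_bigr => y _.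
by rewrite (hrotor.2 u y) -mulrA mulrCA.
Qed.

Let cyl (k : nat) (x : nat -> V) := [set w | forall i, (i <= k)%N -> X i w = x i].
Let hit (n : nat) (y : V) := [set w | X n w = y].

Variables (P : probability Omega R) (u : V).
Hypothesis hX : markov_chain_from p P X u.

Let measurable_hit n y : measurable (hit n y).
Proof. exact: (chain_measurable hX). Qed.

Let measurable_cyl k x : measurable (cyl k x).
Proof.
rewrite (_ : cyl k x = \bigcap_(i in `I_k.+1) hit i (x i)).
  by apply: fin_bigcap_measurable => // i _; exact: measurable_hit.
by apply/seteqP; split => w /= h i ik; exact: h.
Qed.

(** The Markov property speaks of cylinders along one path, so a cylinder followed by a hit of [y]
    is presented as a longer cylinder. *)
Let extend k (x : nat -> V) y : nat -> V := fun i => if (i <= k)%N then x i else y.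

Let cyl_extend k x y : cyl k.+1 (extend k x y) = cyl k x `&` hit k.+1 y.
Proof.
apply/seteqP; split => w /=.
  move=> h; split => [i ik|]; last by have := h k.+1 (leqnn _);
    rewrite /extend ltnn.
  by have := h i (leqW ik); rewrite /extend ik.
move=> [h1 h2] i; rewrite /extend leq_eqVlt => /predU1P[->|];
  first by rewrite ltnn.
by rewrite ltnS => ik; rewrite ik; exact: h1.
Qed.

Let cyl_hit k x y : P (cyl k x `&` hit k.+1 y) = P (cyl k x) * (p (x k) y)%:E.
Proof.
have := chain_step hX k (extend k x y); rewrite -/(cyl k.+1 _) cyl_extend => ->.
rewrite /extend leqnn ltnn; congr (P _ * _).
by apply/seteqP; split => w /= h i ik; have := h i ik; rewrite ik.
Qed.

Let splitDI (A B : set Omega) : measurable A -> measurable B ->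
  P A = P (A `\` B) + P (A `&` B).
Proof. exact: measureDI. Qed.

(** The transition probabilities to the distinct successors sum to 1, so the part of the cylinder
    where the next position is not a successor ([PDU]) is null. *)
Let cyl_split k x (B : set Omega) : measurable B ->
  P (cyl k x `&` B) =
  \sum_(y <- undup (succ (x k))) P (cyl k x `&` hit k.+1 y `&` B).
Proof.
move=> mB; set s := undup _.
pose U := \bigcup_(y in [set` s]) hit k.+1 y.
have mU : measurable U by apply: fin_bigcup_measurable => // y _;
  exact: measurable_hit.
have addU C : measurable C ->
    P (cyl k x `&` U `&` C) = \sum_(y <- s) P (cyl k x `&` hit k.+1 y `&` C).
  move=> mC; rewrite (fsbig_seq _ _ (undup_uniq _)) -measure_fin_bigcup //.
  - congr (P _); apply/seteqP; split => w /=.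
      by move=> [[hA [y ys hy]] hC]; exists y.
    by move=> [y ys [[hA hy] hC]]; do 2!split => //; exists y.
  - by move=> y y' _ _ [w [[[_ <-] _] [[_ <-] _]]].
  - by move=> y _; apply: measurableI => //; exact: measurableI.
have PU : P (cyl k x `&` U) = P (cyl k x).
  have := addU setT measurableT; rewrite setIT => ->.
  under eq_bigr do rewrite setIT cyl_hit.
  rewrite -[P (cyl k x)]fineK ?fin_num_measure//.
  under eq_bigr do rewrite -EFinM.
  rewrite sumEFin -mulr_sumr; congr (_%:E); rewrite -[RHS]mulr1;
    congr (_ * _)%R.
  under eq_bigr do rewrite -[p _ _]mulr1.
  rewrite transition_sum big_const_seq count_predT iter_addr_0 mulVf//.
  by rewrite pnatr_eq0 -lt0n (hrotor.1 (x k)).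
have PDU : P (cyl k x `\` U) = 0.
  have fP := @fin_num_measure _ _ _ P _ (measurable_cyl k x).
  have := splitDI _ _ (measurable_cyl k x) mU; rewrite PU.
  have -> : P (cyl k x `\` U) = (fine (P (cyl k x `\` U)))%:E.
    by rewrite fineK// fin_num_measure//; exact: measurableD.
  by rewrite -(fineK fP) -EFinD => -[] h; congr (_%:E); lra.
rewrite (splitDI _ _ _ mU); last exact: measurableI.
rewrite [X in X + _](_ : _ = 0) ?add0e -?addU//.
  by congr (P _); rewrite setIAC.
apply: (subset_measure0 _ _ _ PDU).
- by apply: measurableD => //; exact: measurableI.
- exact: measurableD.
- by move=> w [[? ?] ?].
Qed.

(** Induction on [n], conditioning on position [k.+1]; [k] and [x] vary so that the hypothesis
    applies to the extended cylinder. *)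
Let cyl_visit n k x :
  P (cyl k x `&` hit (k + n) b) = P (cyl k x) * (visit_probability n (x k))%:E.
Proof.
elim: n k x => [|n IH] k x /=.
  rewrite addn0; case: eqP => xk; rewrite ?mule1 ?mule0.
    by congr (P _); apply/seteqP; split => [w []//|w h]; split => //;
      rewrite /hit /= h.
  rewrite (_ : _ `&` _ = set0) ?measure0//; apply/seteqP;
    split => // w [/= h1 h2].
  by apply: xk; rewrite -h1.
rewrite cyl_split// -transition_sum.
under eq_bigr => y _.
  rewrite -cyl_extend addnS -addSn IH cyl_extend cyl_hit.
  rewrite {1}/extend ltnn -[P (cyl k x)]fineK ?fin_num_measure// -!EFinM -mulrA; over.
by rewrite sumEFin -mulr_sumr EFinM fineK// fin_num_measure.
Qed.

(** The chain starts at [u] almost surely, so intersecting with the cylinder of length zero does not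
    change the probability. *)
Lemma measure_visit n : P [set w | X n w = b] = (visit_probability n u)%:E.
Proof.
have h0 : cyl 0 (fun=> u) = hit 0 u.
  by apply/seteqP; split => w /=; [apply|move=> h i; rewrite leqn0 => /eqP ->].
have P1 : P (hit 0 u) = 1 := chain_start hX.
have := cyl_visit n 0 (fun=> u); rewrite h0 P1 mul1e add0n => <-.
rewrite -/(hit n b) (splitDI _ _ (measurable_hit n b) (measurable_hit 0 u)).
rewrite [X in X + _](_ : _ = 0) ?add0e 1?setIC//.
apply: (subset_measure0 _ _ _ (_ : P (~` hit 0 u) = 0)).
- by apply: measurableD.
- exact: measurableC.
- by move=> w [].
- by rewrite probability_setC// P1 subee.
Qed.

Lemma integral_visits :
  \int[P]_w \sum_(0 <= t <oo) ((X t w == b)%:R)%:E =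
  \sum_(0 <= t <oo) (visit_probability t u)%:E.
Proof.
have E t w : ((X t w == b)%:R)%:E = (\1_(hit t b) w)%:E :> \bar R.
  by rewrite indicE (_ : (w \in hit t b) = (X t w == b))//; apply/idP/eqP;
    rewrite in_setE.
rewrite integral_nneseries//.
- apply: eq_eseriesr => t _; under eq_integral do rewrite E.
  by rewrite integral_indic// setIT; exact: measure_visit.
- by move=> t; under eq_fun do rewrite E;
  apply/measurable_EFinP/measurable_indic.
Qed.

End Chain.

(** Term 0 of the series is the indicator of [u == b]; the later terms are averages over successors
    by the recursion of [visit_probability], and nonnegative series may be rearranged in the
    extended reals. *)
Lemma expected_visits_first_step (R : realType) (V : countType)
    (dsp : measure_display) (Omega : measurableType dsp) (p : V -> V -> R)
    (succ : V -> seq V) (P : V -> probability Omega R) (X : nat -> Omega -> V)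
    (b u : V) :
  rotor_mechanism p succ -> (forall u, markov_chain_from p (P u) X u) ->
  expected_visits P X b u = (u == b)%:R%:E + ((rotor_degree succ u)%:R^-1)%:E *
    \sum_(w <- succ u) expected_visits P X b w.
Proof.
move=> hrotor hX.
have ge0 n v : 0 <= (visit_probability succ b n v)%:E :> \bar R.
  by rewrite lee_fin visit_probability_ge0.
under eq_bigr do rewrite /expected_visits (integral_visits _ _ _ b hrotor _ _ (hX _)).
rewrite /expected_visits (integral_visits _ _ _ b hrotor _ _ (hX _)).
rewrite nneseries_recl//; congr (_ + _).
rewrite -nneseries_sum// -nneseriesZl; last by move=> i _; exact: sume_ge0.
rewrite -nneseries_addn//; apply: eq_eseriesr => i _.
by rewrite addn1 /= EFinM sumEFin.
Qed.

(** * Comparison of the total oscillation with the sum in [K5] *)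

(** The increment from [v] to [w] is at most [|g v - g w| + (v == b)] in absolute value. The
    indicators add up to at most the degree of [b], and degree times [p v w] is the multiplicity of
    [w] among the successors of [v]. *)
Lemma oscillation_sum_le (R : realType) (V : countType) (p : V -> V -> R)
    (succ : V -> seq V) (g : V -> R) (b : V) (S : seq V) :
  rotor_mechanism p succ -> uniq S ->
  (\sum_(v <- S) oscillation succ g b v)%:E <=
  (rotor_degree succ b)%:R%:E + \esum_(e in [set: V * V])
     ((rotor_degree succ e.1)%:R * p e.1 e.2)%:E * `|(g e.1)%:E - (g e.2)%:E|.
Proof.
move=> hrotor uS.
pose c (e : V * V) := ((rotor_degree succ e.1)%:R * p e.1 e.2 * `|g e.1 - g e.2|)%R.
have Ec e : ((rotor_degree succ e.1)%:R * p e.1 e.2)%:E * `|(g e.1)%:E - (g e.2)%:E|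
          = (c e)%:E by rewrite /c !EFinM.
under eq_esum do rewrite Ec.
have osc_le v : (oscillation succ g b v <=
    (v == b)%:R * (rotor_degree succ v)%:R + \sum_(w <- undup (succ v)) c (v, w))%R.
  have -> : (\sum_(w <- undup (succ v)) c (v, w) = \sum_(w <- succ v) `|g v - g w|)%R.
    rewrite -[RHS]sum_undup_count; apply: eq_bigr => w _;
      rewrite /c /= (hrotor.2 v w).
    by rewrite mulrCA divff ?mulr1// pnatr_eq0 -lt0n (hrotor.1 v).
  have -> : ((rotor_degree succ v)%:R = \sum_(w <- succ v) (1 : R))%R.
    by rewrite big_const_seq count_predT iter_addr_0.
  rewrite mulr_sumr -big_split /=; apply: ler_sum => w _.
  rewrite /increment mulr1 addrC (le_trans (ler_normD _ _))// distrC.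
  by rewrite normr_nat.
have sum_b : (\sum_(v <- S) (v == b)%:R * (rotor_degree succ v)%:R
             <= (rotor_degree succ b)%:R :> R)%R.
  under eq_bigr do rewrite mulr_natl mulrb.
  rewrite -big_mkcond /= (eq_bigr (fun=> (rotor_degree succ b)%:R)%R);
    last first.
    by move=> v /eqP ->.
  rewrite big_const_seq iter_addr_0 -[leRHS]mulr1n.
  rewrite ler_wpMn2l// count_uniq_mem//; exact: leq_b1.
apply: (@le_trans _ _ ((rotor_degree succ b)%:R
    + \sum_(v <- S) \sum_(w <- undup (succ v)) c (v, w))%R%:E).
  rewrite lee_fin; apply: le_trans (ler_sum _ (fun v _ => osc_le v)) _.
  by rewrite big_split lerD2r.
rewrite EFinD leeD2l//; apply: esum_ge.
(* The infinite sum is bounded below by its restriction to these finitely many pairs. *)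
pose E := [seq (v, w) | v <- S, w <- undup (succ v)].
exists [set` E]; first by split; [exact: finite_seq|move=> ? _].
have uE : uniq E.
  by apply: allpairs_uniq_dep => [//|v _|[v w] [v' w'] _ _ /= [-> ->]//];
    exact: undup_uniq.
by rewrite -fsbig_seq// sumEFin big_allpairs_dep.
Qed.

(** * Passage from extended to real values and the final estimate *)

Theorem theorem9 (R : realType) (V : countType) (p : V -> V -> R)
    (succ : V -> seq V) (dsp : measure_display) (Omega : measurableType dsp)
    (P : V -> probability Omega R) (X : nat -> Omega -> V)
    (hp : transition_probabilities p)
    (hrat : rational_transitions p)
    (hfin : finitely_many_transitions p)
    (hrotor : rotor_mechanism p succ)
    (hX : forall u, markov_chain_from p (P u) X u)
    (hirr : irreducible_chain P X)
    (htrans : transient_chain P X)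
    (a b : V) (g : V -> \bar R)
    (hg : forall v, g v = expected_visits P X b v)
    (hlimsup : forall eps : R, (0 < eps)%R -> finite_set [set v | eps%:E < g v])
    (hK5 : K5 p succ g b < +oo)
    (r0 : V -> nat) (hr0 : rotor_configuration succ r0)
    (m t : nat) (hm : (1 <= m)%N)
    (hvisits : forall v, visits R succ a r0 (m, t) v < +oo) :
  `|g a - visits R succ a r0 (m, t) b / m%:R%:E| <= K5 p succ g b / m%:R%:E.
Proof.
have g_ge0 v : 0 <= g v.
  by rewrite hg; apply: integral_ge0 => w _; apply: nneseries_ge0 => n _ _;
    rewrite lee_fin.
pose esc := \esum_(e in [set: V * V])
     ((rotor_degree succ e.1)%:R * p e.1 e.2)%:E * `|g e.1 - g e.2|.
have esc_ge0 : 0 <= esc.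
  apply: esum_ge0 => e _; rewrite mule_ge0// lee_fin mulr_ge0//.
  by case/andP: (hp.1 e.1 e.2).
have sup_ge v : g v <= ereal_sup (range g) by apply: ereal_sup_ubound; exists v.
have sup_ge0 : 0 <= ereal_sup (range g) by exact: le_trans (sup_ge a).
have half_ge0 : 0 <= (2^-1)%:E * ((rotor_degree succ b)%:R%:E + esc).
  by rewrite mule_ge0 ?adde_ge0// lee_fin.
(* Finiteness of [K5] passes to its nonnegative constituents, so [g] is real-valued and [gr] can
   replace it. *)
have sup_fin : ereal_sup (range g) \is a fin_num.
  by rewrite ge0_fin_numE// (le_lt_trans _ hK5)// leeDl.
have esc_fin : esc \is a fin_num.
  rewrite ge0_fin_numE// ltey; apply/eqP => esc_oo; move: hK5.
  by rewrite /K5 -/esc esc_oo addey// gt0_muley ?lte_fin// addey// -(fineK sup_fin).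
have g_fin v : g v \is a fin_num.
  by rewrite ge0_fin_numE// (le_lt_trans (sup_ge v))// -ge0_fin_numE.
pose gr v := fine (g v).
have Eg v : g v = (gr v)%:E by rewrite fineK.
have degree_gt0 := hrotor.1.
(* This is the first-step equation multiplied by the degree of [v]. *)
have increment_sum0 v : (\sum_(w <- succ v) increment gr b v w = 0)%R.
  have := expected_visits_first_step _ _ _ _ p succ P X b v hrotor hX.
  rewrite -hg Eg; under eq_bigr do rewrite -hg Eg.
  rewrite sumEFin -EFinM -EFinD => -[] Egv.
  rewrite /increment 2!big_split /= !big_const_seq count_predT !iter_addr_0.
  rewrite -/(rotor_degree succ v) -[X in (_ + X + _)%R]mulr_natl -[X in (_ + X)%R]mulr_natl.
  have d0 : ((rotor_degree succ v)%:R != 0 :> R)%R by rewrite pnatr_eq0 -lt0n.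
  by rewrite Egv mulrN mulrDr mulVKf//; lra.
have defined_m := visits_defined_level _ _ _ _ _ _ hvisits.
have gr_vanishes (eps : R) : (0 < eps)%R -> finite_set [set v | (eps < gr v)%R].
  by move=> /hlimsup; congr finite_set; apply/funext => v /=;
    rewrite Eg lte_fin.
pose C := ((rotor_degree succ b)%:R + fine esc)%R.
pose G := fine (ereal_sup (range g)).
have hC S : uniq S -> (\sum_(v <- S) oscillation succ gr b v <= C)%R.
  move=> uS; rewrite -lee_fin EFinD fineK//.
  apply: le_trans (oscillation_sum_le _ _ _ _ gr b _ hrotor uS) _.
  by under eq_esum do rewrite -!Eg.
have hG v : (gr v <= G)%R by rewrite -lee_fin -Eg fineK.
have gr_ge0 v : (0 <= gr v)%R by rewrite -lee_fin -Eg.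
have [n [-> hn]] := transfinite_visits_bound _ _ a _ increment_sum0 degree_gt0
  gr_ge0 gr_vanishes _ hr0 C G m t defined_m hC hG.
have m_gt0 : (0 < m%:R :> R)%R by rewrite ltr0n.
have -> : K5 p succ g b = (G + C / 2)%:E.
  by rewrite /K5 -/esc -(fineK sup_fin) -(fineK esc_fin) -EFinD [(C / 2)%R]mulrC.
(* As [m] is nonzero, extended division is real division; multiplying by [m] leaves [hn]. *)
rewrite Eg inver gt_eqF// -!EFinM -EFinB lee_fin.
rewrite -(ler_pM2r m_gt0) mulfVK ?gt_eqF//.
rewrite -{2}(gtr0_norm m_gt0) -normrM mulrBl mulfVK ?gt_eqF// distrC.
by rewrite [X in (_ - X)%R]mulrC.
Qed.
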